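(* There exists a function $g(\delta,k)>0$, defined for integers $k\ge 1$ and reals $0<\delta<1$, such that for any fixed $k$ and $\delta$ and all sufficiently large $n$ the following holds: if $x_1,\dots,x_n$ are real numbers with $\sum_{i=1}^n x_i\ge 0$ and no $x_i$ is $(1-\delta)$-moderately large, then the number $N$ of $k$-element subsets $S\subseteq\{1,\dots,n\}$ with $\sum_{i\in S}x_i\ge 0$ satisfies $N\ge g(\delta,k)\binom{n}{k}$.
   Context: For a constant $0\le\delta<1$, a number $x_i$ (among $x_1,\dots,x_n$) is called $(1-\delta)$-moderately large if there are at least $(1-\delta)\binom{n-1}{k-1}$ $k$-element subsets $S\subseteq\{1,\dots,n\}$ with $i\in S$ and $\sum_{j\in S}x_j\ge 0$. *)

(* Defs.v *)
From HB Require Import structures.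
From mathcomp Require Import all_boot all_order all_algebra.
From mathcomp Require Import reals.

Set Implicit Arguments.
Unset Strict Implicit.
Unset Printing Implicit Defensive.

Import Order.TTheory GRing.Theory Num.Theory.
Local Open Scope ring_scope.

Definition nonneg_ksubsets (R : realType) (n k : nat) (x : 'I_n -> R) :
    {set {set 'I_n}} :=
  [set S : {set 'I_n} | (#|S| == k) && (0 <= \sum_(j in S) x j)].

(* [moderately_large k delta x i] says that x_i is (1 - delta)-moderately large:
   the second argument is delta itself, not 1 - delta, with 0 <= delta < 1.
   It is a property of the index i, not of the real value x i. *)
Definition moderately_large (R : realType) (n k : nat) (delta : R)
    (x : 'I_n -> R) (i : 'I_n) : Prop :=
  (1 - delta) * ('C(n.-1, k.-1))%:R
    <= #|[set S in nonneg_ksubsets k x | i \in S]|%:R.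

(* Main.v *)
(* Let M > 0 be the largest number.  A k-subset through its index with negative
   sum contains some j with k x_j < -M.  As M is not moderately large, such
   k-subsets form a delta-fraction of all k-subsets through that index, so there
   are at least a constant times n such indices j.  They contribute at most
   -c n M to the sum, which must be balanced by numbers that are at most M:
   linearly many x_i are nonnegative, and every k-subset of those has
   nonnegative sum. *)
Require Import Defs.
From HB Require Import structures.
From mathcomp Require Import all_boot all_order all_algebra.
From mathcomp Require Import reals zify ring lra.

Set Implicit Arguments.
Unset Strict Implicit.
Unset Printing Implicit Defensive.

Import Order.TTheory GRing.Theory Num.Theory.
Local Open Scope ring_scope.

(** Removing [D] is a bijection onto the subsets of the complement of [D] that have [k - #|D|]
    elements. *)
Lemma card_ksubsets_over (T : finType) (D : {set T}) (k : nat) :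
  (#|D| <= k)%N ->
  #|[set S : {set T} | (#|S| == k) && (D \subset S)]|
    = 'C(#|T| - #|D|, k - #|D|).
Proof.
move=> leDk.
have -> : (#|T| - #|D| = #|~: D|)%N by rewrite [RHS]cardsCs setCK.
rewrite -cards_draws.
rewrite -(@card_in_imset _ _ (fun U => U :\: D)) => [|S1 S2]; last first.
  rewrite !inE => /andP[_ s1] /andP[_ s2] e.
  by rewrite -(setID S1 D) -(setID S2 D) e (setIidPr s1) (setIidPr s2).
congr #|pred_of_set _|; apply/setP=> U; apply/imsetP/idP.
  case=> S; rewrite !inE => /andP[/eqP cS sD] ->.
  by rewrite setDE subsetIr -setDE cardsDS // cS eqxx.
rewrite !inE => /andP[sU /eqP cU].
have dUD : [disjoint U & D] by rewrite disjoints_subset.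
exists (U :|: D).
  rewrite !inE subsetUr andbT cardsU disjoint_setI0 // cards0 cU subn0.
  by rewrite subnK.
by rewrite setDUl setDv setU0; apply/esym/setDidPl.
Qed.

Lemma leq_card_bigcup (I T : finType) (B : {set I}) (F : I -> {set T}) :
  (#|\bigcup_(i in B) F i| <= \sum_(i in B) #|F i|)%N.
Proof.
elim/big_rec2: _ => [|i s A _ leAs]; first by rewrite cards0.
by rewrite (leq_trans (leq_card_setU _ _)) ?leq_add2l.
Qed.

Lemma expn_le_ffact (n k : nat) : ((n - k) ^ k <= n ^_ k)%N.
Proof.
elim: k => // k IHk; rewrite expnSr ffactnSr leq_mul ?leq_sub2l //.
apply: leq_trans IHk; case: k => // k.
by rewrite leq_exp2r // leq_sub2l.
Qed.

Lemma ffact_le_expn (n k : nat) : (n ^_ k <= n ^ k)%N.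
Proof. by elim: k => // k IHk; rewrite expnSr ffactnSr leq_mul ?leq_subr. Qed.

Section LargestNumber.

Variables (R : realFieldType) (n : nat) (x : 'I_n -> R) (i0 : 'I_n).

(** The threshold is [- x i0 / k], cleared of the division. *)
Definition very_negative (k : nat) := [set j | k%:R * x j < - x i0].

(** If [S] contains [i0] and no very negative index, then [k.+1] times its sum is at least (k+1)
    x_{i0} - k x_{i0} = x_{i0} >= 0. So each counted [S] contains a pair {i0, j} with [j] very
    negative. Such a pair lies in C(n-2, k-1) sets, and (n-1) C(n-2, k-1) = k C(n-1, k); a union
    bound over [j] finishes. *)
Lemma card_negative_ksubsets_at (k : nat) :
  0 <= x i0 ->
  (n.-1 * #|[set S : {set 'I_n} |
             [&& #|S| == k.+1, i0 \in S & (\sum_(j in S) x j < 0)%R]]|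
    <= #|very_negative k.+1| * (k * 'C(n.-1, k)))%N.
Proof.
move=> x0_ge0; set F := [set S | _].
pose G j := [set S : {set 'I_n} | (#|S| == k.+1) && ([set i0; j] \subset S)].
have FG : F \subset \bigcup_(j in very_negative k.+1) G j.
  apply/subsetP=> S; rewrite inE => /and3P[cS i0S sum_lt0].
  have [j /andP[jS jB]|noB] := pickP [pred j in S | j \in very_negative k.+1].
    by apply/bigcupP; exists j; rewrite // inE cS subUset !sub1set i0S.
  suff : 0 <= k.+1%:R * \sum_(j in S) x j.
    by rewrite pmulr_rge0 // leNgt sum_lt0.
  rewrite (bigD1 i0) //= mulrDr mulr_sumr.
  have : \sum_(j in S | j != i0) - x i0 <=
         \sum_(j in S | j != i0) k.+1%:R * x j.
    apply: ler_sum => j /andP[jS _]; have := noB j.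
    by rewrite /= jS inE /= => /negbT; rewrite -leNgt.
  rewrite (eq_bigl (mem (S :\ i0))) => [|j]; last by rewrite !inE andbC.
  rewrite sumr_const -[X in _ *+ X]/(#|S :\ i0|).
  have -> : #|S :\ i0| = k.
    by move: cS; rewrite (cardsD1 i0) i0S => /eqP [].
  by rewrite -mulr_natl -natr1; lra.
have cG j : j \in very_negative k.+1 -> (n.-1 * #|G j| <= k * 'C(n.-1, k))%N.
  (* Since [x i0] is nonnegative, [i0] is not itself very negative. *)
  rewrite inE => xj; have ij : i0 != j.
    apply: contraTneq xj => <-; rewrite -leNgt -subr_ge0 opprK.
    by rewrite addr_ge0 ?mulr_ge0.
  (* For [k = 0] the sets are singletons, too small to contain the pair. *)
  rewrite /G; case: k xj {FG F G} => [|k] xj.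
    rewrite (_ : [set _ | _] = set0) ?cards0 ?muln0 //.
    apply/setP=> S; rewrite !inE; apply/negP => /andP[/eqP cS /subset_leq_card].
    by rewrite cards2 ij cS.
  rewrite card_ksubsets_over cards2 ij // card_ord !subSS !subn0 subn2.
  by rewrite mul_bin_diag.
apply: leq_trans (_ : n.-1 * (\sum_(j in very_negative k.+1) #|G j|) <= _)%N.
  by rewrite leq_mul2l (leq_trans (subset_leq_card FG)) ?leq_card_bigcup ?orbT.
by rewrite big_distrr /= -sum_nat_const leq_sum.
Qed.

(** With M = [x i0], each term satisfies k x_i <= k M [x_i >= 0] - M [i very negative]. Summing over
    i and dividing by M > 0 compares the two counts. *)
Lemma card_very_negative_le (k : nat) :
  0 < x i0 -> (forall i, x i <= x i0) -> 0 <= \sum_i x i ->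
  (#|very_negative k| <= k * #|[set i | (0 <= x i)%R]|)%N.
Proof.
move=> x0_gt0 x_le sum_ge0; set P := [set i | _]; set B := very_negative k.
rewrite -(ler_nat R) natrM -(ler_pM2r x0_gt0).
have cM (A : {set 'I_n}) : #|A|%:R * x i0 =
    \sum_i (if i \in A then x i0 else 0).
  by rewrite -big_mkcond sumr_const mulr_natl.
rewrite -mulrA !cM mulr_sumr -subr_ge0 -sumrB.
have : 0 <= k%:R * \sum_i x i by rewrite mulr_ge0.
rewrite mulr_sumr => /le_trans; apply; apply: ler_sum => i _; rewrite !inE.
have := ler_wpM2l (ler0n R k) (x_le i).
case: ltP => xB; case: (leP 0 (x i)) => [xi_ge0|/ltW xi_le0] _ /=.
- by have := mulr_ge0 (ler0n R k) xi_ge0; lra.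
- by lra.
- by rewrite subr0 ler_wpM2l.
- by rewrite mulr0 subr0 mulr_ge0_le0.
Qed.

End LargestNumber.

(* k! C(n, k) <= n^k and (p - k)^k <= k! C(p, k); for p >= 2k, half of p
   survives the subtraction. *)
Lemma bin_ratio_ge (R : realFieldType) (c : R) (k n p : nat) :
  0 <= c -> 2%:R * c * n%:R <= p%:R -> (2 * k <= p)%N ->
  c ^+ k * 'C(n, k)%:R <= 'C(p, k)%:R.
Proof.
move=> c_ge0 cn_le_p k_le_p.
have fk : 0 < k`!%:R :> R by rewrite ltr0n fact_gt0.
rewrite -(ler_pM2r fk) -mulrA -!natrM !bin_ffact.
apply: le_trans (_ : (c * n%:R) ^+ k <= _).
  by rewrite exprMn ler_wpM2l ?exprn_ge0 // -natrX ler_nat ffact_le_expn.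
apply: le_trans (_ : ((p - k) ^ k)%:R <= _); last first.
  by rewrite ler_nat expn_le_ffact.
rewrite natrX lerXn2r ?nnegrE ?mulr_ge0 // natrB; last by lia.
by move: k_le_p; rewrite -(ler_nat R) natrM; lra.
Qed.

Lemma card_nonneg_ksubsets_ge (R : realType) (n k : nat) (x : 'I_n -> R) :
  ('C(#|[set i | (0 <= x i)%R]|, k) <= #|nonneg_ksubsets k x|)%N.
Proof.
rewrite -cards_draws; apply/subset_leq_card/subsetP => S.
rewrite !inE => /andP[/subsetP sSP ->] /=.
by apply: sumr_ge0 => i /sSP; rewrite inE.
Qed.

Lemma card_nonneg_linear (R : realType) (n k : nat) (delta : R)
    (x : 'I_n -> R) :
  (1 <= k <= n)%N -> 0 < delta -> 0 <= \sum_(i < n) x i ->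
  (forall i, ~ moderately_large k delta x i) ->
  delta * n.-1%:R <= k%:R ^+ 2 * #|[set i | 0 <= x i]|%:R.
Proof.
case: k => // k /= lt_kn delta_gt0 sum_ge0 notML.
have n_gt0 : (0 < n)%N by apply: leq_trans lt_kn.
have [i0 _ x_le] := @arg_maxP _ _ _ (Ordinal n_gt0) predT x isT.
have {}x_le i : x i <= x i0 by apply: x_le.
pose N := [set S in nonneg_ksubsets k.+1 x | i0 \in S].
pose F := [set S : {set 'I_n} |
             [&& #|S| == k.+1, i0 \in S & \sum_(j in S) x j < 0]].
(* The k-subsets through [i0] split by the sign of their sum; from here on [k] stands for the
   original k minus one. *)
have cNF : (#|N| + #|F| = 'C(n.-1, k))%N.
  have := @card_ksubsets_over _ [set i0] k.+1.
  rewrite cards1 card_ord !subn1 => <- //.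
  rewrite -[RHS](cardsID (nonneg_ksubsets k.+1 x)); congr (_ + _)%N;
      apply: eq_card.
    by move=> S; rewrite !inE sub1set; case: eqP; case: (i0 \in S);
      rewrite ?andbF ?andbT.
  by move=> S; rewrite !inE sub1set ltNge; case: eqP; case: (i0 \in S);
    rewrite ?andbF ?andbT.
have F_gt : delta * 'C(n.-1, k)%:R < #|F|%:R.
  have /negP := notML i0; rewrite -ltNge /= -cNF natrD => H.
  by move: H; rewrite -/N; lra.
(* Otherwise all entries are nonpositive, so any partial sum is at least the total, which is
   nonnegative. Then [F] would be empty, against [F_gt]. *)
have x0_gt0 : 0 < x i0.
  rewrite ltNge; apply/negP=> x0_le0.
  have x_le0 i : x i <= 0 by apply: le_trans (x_le i) x0_le0.
  suff F0 : F = set0.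
    by move: F_gt; rewrite F0 cards0 ltNge mulr_ge0 // ltW.
  apply/setP=> S; rewrite !inE; apply/negP => /and3P[_ _].
  rewrite ltNge => /negP; apply; apply: le_trans sum_ge0 _.
  rewrite [X in X <= _](bigID (mem S)) /= gerDl.
  by apply: sumr_le0.
have := card_very_negative_le k.+1 x0_gt0 x_le sum_ge0.
have := card_negative_ksubsets_at k (ltW x0_gt0); rewrite -/F.
set m := #|_ _|; set p := #|[set i | _]| => nF mp.
have C_gt0 : 0 < 'C(n.-1, k)%:R :> R by rewrite ltr0n bin_gt0; lia.
rewrite -(ler_pM2r C_gt0).
apply: le_trans (_ : (n.-1 * #|F|)%:R <= _).
  by rewrite natrM mulrAC mulrC ler_wpM2l // ltW.
(* What remains is m k <= (k+1)^2 p, which follows from m <= (k+1) p. *)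
rewrite -natrX -!natrM ler_nat (leq_trans nF) // mulnA leq_mul2r.
by apply/orP; right; nia.
Qed.

Theorem theorem1p4 (R : realType) :
  exists g : R -> nat -> R,
    (forall (delta : R) (k : nat),
       (1 <= k)%N -> 0 < delta -> delta < 1 -> 0 < g delta k) /\
    (forall (delta : R) (k : nat),
       (1 <= k)%N -> 0 < delta -> delta < 1 ->
       exists n0 : nat, forall n : nat, (n0 <= n)%N ->
         forall x : 'I_n -> R,
           0 <= \sum_(i < n) x i ->
           (forall i : 'I_n, ~ moderately_large k delta x i) ->
           g delta k * ('C(n, k))%:R <= #|nonneg_ksubsets k x|%:R).
Proof.
(* One factor 2 in the 4 pays for replacing n - 1 by n / 2, the other is the 2 in [bin_ratio_ge]. *)
exists (fun delta k => (delta / (4 * k%:R ^+ 2)) ^+ k).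
split=> delta k k_gt0 d_gt0 d_lt1.
  by rewrite exprn_gt0 // divr_gt0 // mulr_gt0 // exprn_gt0 // ltr0n.
have K_ge1 : 1 <= k%:R :> R by rewrite ler1n.
(* This makes delta n >= 4 k^3, which yields k <= n, n >= 2 and, at the end, p >= 2k. *)
exists (Num.bound (4 * k%:R ^+ 3 / delta)).+1 => n lt_n x sum_ge0 notML.
have n_ge : 4 * k%:R ^+ 3 <= delta * n%:R.
  rewrite -ler_pdivrMl // mulrC.
  apply: ltW (lt_le_trans (archi_boundP _) _).
    by rewrite divr_ge0 ?mulr_ge0 ?exprn_ge0 // ltW.
  by rewrite ler_nat ltnW.
have K3 : k%:R <= k%:R ^+ 3 :> R by rewrite ler_eXnr.
have dn : delta * n%:R <= n%:R by rewrite ler_piMl // ltW.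
have k_le_n : (k <= n)%N by rewrite -(ler_nat R); lra.
have n_ge2 : (2 <= n)%N by rewrite -(ler_nat R); lra.
have := @card_nonneg_linear R n k delta x.
rewrite k_gt0 k_le_n => /(_ isT d_gt0 sum_ge0 notML).
set p := #|[set i | _]| => p_ge.
have n1_ge : n%:R <= 2 * n.-1%:R :> R by rewrite -natrM ler_nat; lia.
have K2_gt0 : 0 < k%:R ^+ 2 :> R by rewrite exprn_gt0; lra.
have dn2 : delta * n%:R <= 2 * (k%:R ^+ 2 * p%:R).
  have := ler_wpM2l (ltW d_gt0) n1_ge; rewrite mulrCA; lra.
apply: le_trans (_ : 'C(p, k)%:R <= _); last first.
  by rewrite ler_nat card_nonneg_ksubsets_ge.
apply: bin_ratio_ge.
- by rewrite divr_ge0 ?(ltW d_gt0) ?mulr_ge0 // ltW.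
- have -> : 2 * (delta / (4 * k%:R ^+ 2)) * n%:R =
          (delta * n%:R) / (2 * k%:R ^+ 2).
    by field; rewrite gt_eqF //; lra.
  by rewrite ler_pdivrMr; lra.
(* After scaling by k^2: 2 k^3 <= delta n / 2 <= k^2 p. *)
- rewrite -(ler_nat R) natrM -(ler_pM2l K2_gt0).
  have -> : k%:R ^+ 2 * (2 * k%:R) = 2 * k%:R ^+ 3 :> R by ring.
  lra.
Qed.
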